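(* Let $R$ be a commutative ring with identity. Then the following statements are equivalent. (1) $R$ is a von Neumann regular ring. (2) Every $R$-module has an almost projective envelope with the unique mapping property.
   Context: All rings are commutative with identity and all modules are unitary. An $R$-module $M$ is almost projective if $\mathrm{Ext}^1_R(M,N)=0$ for every maximal ideal $\mathfrak{m}$ of $R$ and every $R_{\mathfrak{m}}$-module $N$ (viewed as an $R$-module). For a class $\mathscr{P}$ of $R$-modules and an $R$-module $M$, an $R$-homomorphism $f:M\to P$ with $P\in\mathscr{P}$ is a $\mathscr{P}$-preenvelope if for every $P'\in\mathscr{P}$ the natural map $\mathrm{Hom}_R(P,P')\to\mathrm{Hom}_R(M,P')$, $g\mapsto gf$, is surjective. It is a $\mathscr{P}$-envelope if moreover every endomorphism $h$ of $P$ with $f=hf$ is an automorphism. A $\mathscr{P}$-envelope $f:M\to P$ has the unique mapping property if for every $R$-homomorphism $f':M\to P'$ with $P'\in\mathscr{P}$ there exists a unique $R$-homomorphism $g:P\to P'$ such that $f'=gf$. An almost projective envelope (with the unique mapping property) is a $\mathscr{P}$-envelope (with the unique mapping property) for $\mathscr{P}$ the class of almost projective $R$-modules. *)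

(* Defs.v *)
From HB Require Import structures.
From mathcomp Require Import all_boot all_algebra ring.
From mathcomp Require Import boolp classical_sets.

Set Implicit Arguments.
Unset Strict Implicit.
Unset Printing Implicit Defensive.

Import GRing.Theory.

Local Open Scope classical_set_scope.
Local Open Scope ring_scope.
Local Open Scope quotient_scope.

(* Rings are [comPzRingType]s, so the zero ring is allowed throughout. *)

Definition von_neumann_regular (R : comPzRingType) : Prop :=
  forall a : R, exists x : R, a = a * x * a.

Definition is_ideal (R : comPzRingType) (I : set R) : Prop :=
  [/\ I 0,
      forall x y, I x -> I y -> I (x + y)
    & forall a x, I x -> I (a * x)].

Record is_maximal_ideal (R : comPzRingType) (m : set R) : Prop := {
  maximal_is_ideal : is_ideal m;
  maximal_proper : ~ m 1;
  maximal_max : forall I : set R,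
    is_ideal I -> m `<=` I -> ~ I 1 -> I `<=` m
}.

Record maximal_ideal (R : comPzRingType) := MaximalIdeal {
  maxideal_pred :> R -> Prop;
  maxidealP : is_maximal_ideal maxideal_pred
}.

Record mul_set (R : comPzRingType) := MulSet {
  mul_set_pred :> R -> Prop;
  mul_set1 : mul_set_pred 1;
  mul_setM : forall x y,
    mul_set_pred x -> mul_set_pred y -> mul_set_pred (x * y)
}.

Module Localization.
Section Localization.
Variables (R : comPzRingType) (S : mul_set R).

Record ratio := Ratio { num : R; den : R; denP : S den }.

HB.instance Definition _ := gen_eqMixin ratio.
HB.instance Definition _ := gen_choiceMixin ratio.

(* [R] may have zero divisors, hence the extra factor [u]. *)
Definition eqv (x y : ratio) : bool :=
  `[< exists2 u, S u & u * (num x * den y) = u * (num y * den x) >].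

Lemma eqv_refl : reflexive eqv.
Proof. by move=> x; apply/asboolP; exists 1 => //; exact: mul_set1. Qed.

Lemma eqv_sym : symmetric eqv.
Proof. by move=> x y; apply/asboolP/asboolP => -[u Su e]; exists u. Qed.

Lemma eqv_trans : transitive eqv.
Proof.
move=> y x z /asboolP[u Su e] /asboolP[v Sv f]; apply/asboolP.
exists (u * v * den y); first by do ?apply: mul_setM => //; exact: denP.
transitivity (v * den z * (u * (num x * den y))); first by ring.
rewrite e.
transitivity (u * den x * (v * (num y * den z))); first by ring.
by rewrite f; ring.
Qed.

Canonical eqv_equiv := EquivRel eqv eqv_refl eqv_sym eqv_trans.

Definition type := {eq_quot eqv}.

HB.instance Definition _ : EqQuotient _ eqv type := EqQuotient.on type.
HB.instance Definition _ := Choice.on type.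

Definition frac (x : ratio) : type := \pi_type x.

Lemma fracP x y :
  frac x = frac y <->
  exists2 u, S u & u * (num x * den y) = u * (num y * den x).
Proof. by split=> [/eqmodP/asboolP|] // h; apply/eqmodP/asboolP. Qed.

Lemma frac_ind (P : type -> Prop) : (forall x, P (frac x)) -> forall a, P a.
Proof. by move=> h; elim/quotW. Qed.

Definition add_ratio (x y : ratio) : ratio :=
  Ratio (num x * den y + num y * den x) (mul_setM (denP x) (denP y)).
Definition opp_ratio (x : ratio) : ratio := Ratio (- num x) (denP x).
Definition mul_ratio (x y : ratio) : ratio :=
  Ratio (num x * num y) (mul_setM (denP x) (denP y)).
Definition of_ring (a : R) : ratio := Ratio a (mul_set1 S).

Definition add (a b : type) : type := frac (add_ratio (repr a) (repr b)).
Definition opp (a : type) : type := frac (opp_ratio (repr a)).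
Definition mul (a b : type) : type := frac (mul_ratio (repr a) (repr b)).

Lemma repr_frac x :
  exists2 u, S u & u * (num (repr (frac x)) * den x)
                   = u * (num x * den (repr (frac x))).
Proof. by apply/fracP; rewrite /frac reprK. Qed.

Lemma fracD x y : add (frac x) (frac y) = frac (add_ratio x y).
Proof.
apply/fracP => /=; have [u Su e] := repr_frac x; have [v Sv f] := repr_frac y.
move: (repr (frac x)) (repr (frac y)) e f => x' y' e f.
exists (u * v); first exact: mul_setM.
transitivity (u * (num x' * den x) * (v * den y' * den y)
  + v * (num y' * den y) * (u * den x' * den x)); first by ring.
by rewrite e f; ring.
Qed.

Lemma fracN x : opp (frac x) = frac (opp_ratio x).
Proof.
apply/fracP => /=; have [u Su e] := repr_frac x; exists u => //.
by rewrite !mulNr !mulrN e.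
Qed.

Lemma fracM x y : mul (frac x) (frac y) = frac (mul_ratio x y).
Proof.
apply/fracP => /=; have [u Su e] := repr_frac x; have [v Sv f] := repr_frac y.
move: (repr (frac x)) (repr (frac y)) e f => x' y' e f.
exists (u * v); first exact: mul_setM.
transitivity (u * (num x' * den x) * (v * (num y' * den y))); first by ring.
by rewrite e f; ring.
Qed.

Lemma frac_eq x y : num x * den y = num y * den x -> frac x = frac y.
Proof. by move=> e; apply/fracP; exists 1; rewrite ?e //; exact: mul_set1. Qed.

Lemma addA : associative add.
Proof.
elim/frac_ind=> x; elim/frac_ind=> y; elim/frac_ind=> z.
by rewrite !fracD; apply: frac_eq => /=; ring.
Qed.

Lemma addC : commutative add.
Proof.
elim/frac_ind=> x; elim/frac_ind=> y.
by rewrite !fracD; apply: frac_eq => /=; ring.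
Qed.

Lemma add0 : left_id (frac (of_ring 0)) add.
Proof. by elim/frac_ind=> x; rewrite fracD; apply: frac_eq => /=; ring. Qed.

Lemma addN : left_inverse (frac (of_ring 0)) opp add.
Proof. by elim/frac_ind=> x; rewrite fracN fracD; apply: frac_eq => /=; ring. Qed.

HB.instance Definition _ := GRing.isZmodule.Build type addA addC add0 addN.

Lemma mulA : associative mul.
Proof.
elim/frac_ind=> x; elim/frac_ind=> y; elim/frac_ind=> z.
by rewrite !fracM; apply: frac_eq => /=; ring.
Qed.

Lemma mulC : commutative mul.
Proof.
elim/frac_ind=> x; elim/frac_ind=> y.
by rewrite !fracM; apply: frac_eq => /=; ring.
Qed.

Lemma mul1 : left_id (frac (of_ring 1)) mul.
Proof. by elim/frac_ind=> x; rewrite fracM; apply: frac_eq => /=; ring. Qed.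

Lemma mulDl : left_distributive mul add.
Proof.
elim/frac_ind=> x; elim/frac_ind=> y; elim/frac_ind=> z.
by rewrite !(fracM, fracD); apply: frac_eq => /=; ring.
Qed.

HB.instance Definition _ :=
  GRing.Zmodule_isComPzRing.Build type mulA mulC mul1 mulDl.

Definition to_loc (a : R) : type := frac (of_ring a).

Lemma to_loc_is_zmod_morphism : zmod_morphism to_loc.
Proof.
move=> a b; rewrite /to_loc.
rewrite -[RHS]/(add (frac (of_ring a)) (opp (frac (of_ring b)))).
by rewrite fracN fracD; apply: frac_eq => /=; ring.
Qed.

Lemma to_loc_is_monoid_morphism : monoid_morphism to_loc.
Proof.
split=> [//|a b].
rewrite -[RHS]/(mul (frac (of_ring a)) (frac (of_ring b))).
by rewrite fracM; apply: frac_eq => /=; ring.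
Qed.

HB.instance Definition _ :=
  GRing.isZmodMorphism.Build R type to_loc to_loc_is_zmod_morphism.
HB.instance Definition _ :=
  GRing.isMonoidMorphism.Build R type to_loc to_loc_is_monoid_morphism.

End Localization.
End Localization.
HB.export Localization.

Section LocalizationAtMaximal.
Variables (R : comPzRingType) (m : maximal_ideal R).

Lemma maximal_compl1 : ~ m 1.
Proof. exact: (maximal_proper (maxidealP m)). Qed.

Lemma maximal_complM x y : ~ m x -> ~ m y -> ~ m (x * y).
Proof.
have [[m0 mD mM] _ mmax] := maxidealP m.
move=> mx my mxy; apply: my.
pose I : set R := [set z | exists a b, m b /\ z = a * x + b].
have idI : is_ideal I.
  split; first by exists 0, 0; split=> //; ring.
  - move=> _ _ [a [b [mb ->]]] [c [d [md ->]]].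
    by exists (a + c), (b + d); split; [exact: mD|ring].
  - move=> c _ [a [b [mb ->]]].
    by exists (c * a), (c * b); split; [exact: mM|ring].
have mI : maxideal_pred m `<=` I by move=> z mz; exists 0, z; split=> //; ring.
have Ix : I x by exists 1, 0; split=> //; ring.
case: (pselect (I 1)) => [[a [b [mb e]]]|nI1]; last first.
  by case: mx; exact: (mmax _ idI mI nI1).
have -> : y = a * (x * y) + y * b.
  by rewrite -[LHS]mul1r [X in X * y]e; ring.
by apply: mD; exact: mM.
Qed.

Definition maximal_compl : mul_set R :=
  @MulSet R (fun x => ~ m x) maximal_compl1 maximal_complM.

Definition localization_at : comPzRingType := Localization.type maximal_compl.

Definition to_localization_at : {rmorphism R -> localization_at} :=
  @Localization.to_loc R maximal_compl.

End LocalizationAtMaximal.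

Definition restrict_scalars (R S : comPzRingType) (phi : {rmorphism R -> S})
  (N : lmodType S) : Type := N.

Section RestrictScalars.
Variables (R S : comPzRingType) (phi : {rmorphism R -> S}) (N : lmodType S).

HB.instance Definition _ := GRing.Zmodule.on (restrict_scalars phi N).

Definition restrict_scale (a : R) (x : restrict_scalars phi N) :
  restrict_scalars phi N := (phi a *: (x : N) : N).

Lemma restrict_scaleA a b x :
  restrict_scale a (restrict_scale b x) = restrict_scale (a * b) x.
Proof. by rewrite /restrict_scale scalerA rmorphM. Qed.

Lemma restrict_scale1 : left_id 1 restrict_scale.
Proof. by move=> x; rewrite /restrict_scale rmorph1 scale1r. Qed.

Lemma restrict_scaleDr : right_distributive restrict_scale +%R.
Proof. by move=> a x y; rewrite /restrict_scale scalerDr. Qed.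

Lemma restrict_scaleDl x : {morph restrict_scale^~ x : a b / a + b}.
Proof. by move=> a b; rewrite /restrict_scale rmorphD scalerDl. Qed.

HB.instance Definition _ :=
  GRing.Zmodule_isLmodule.Build R (restrict_scalars phi N)
    restrict_scaleA restrict_scale1 restrict_scaleDr restrict_scaleDl.

End RestrictScalars.

Definition surjective_fun (T U : Type) (f : T -> U) : Prop :=
  forall y, exists x, f x = y.

Definition projective (R : comPzRingType) (P : lmodType R) : Prop :=
  forall (A B : lmodType R) (p : {linear A -> B}) (f : {linear P -> B}),
    surjective_fun p -> exists g : {linear P -> A}, f =1 p \o g.

Record projective_resolution (R : comPzRingType) (M : lmodType R) := {
  res_term :> nat -> lmodType R;
  res_diff : forall n, {linear res_term n.+1 -> res_term n};
  res_aug : {linear res_term 0 -> M};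
  res_projective : forall n, projective (res_term n);
  res_aug_surj : surjective_fun res_aug;
  res_exact0 : forall x, res_aug x = 0 <-> exists y, res_diff 0 y = x;
  res_exactS : forall n x,
    res_diff n x = 0 <-> exists y, res_diff n.+1 y = x
}.

(* Ext^1(M, N) = H^1(Hom(P, N)) for a projective resolution P of M, up to an
   isomorphism depending on the choice of P: it vanishes when every 1-cocycle
   of Hom(P, N) is a 1-coboundary. *)
Definition Ext1_eq0 (R : comPzRingType) (M N : lmodType R) : Prop :=
  forall (P : projective_resolution M) (g : {linear P 1 -> N}),
    (forall x, g (res_diff P 1 x) = 0) ->
    exists h : {linear P 0 -> N}, g =1 h \o res_diff P 0.

Definition almost_projective (R : comPzRingType) (M : lmodType R) : Prop :=
  forall (m : maximal_ideal R) (N : lmodType (localization_at m)),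
    Ext1_eq0 M (restrict_scalars (to_localization_at m) N).

Section Envelopes.
Variables (R : comPzRingType) (C : lmodType R -> Prop).
Variables (M P : lmodType R) (f : {linear M -> P}).

Definition is_preenvelope : Prop :=
  C P /\
  forall P' : lmodType R, C P' ->
  forall f' : {linear M -> P'}, exists g : {linear P -> P'}, g \o f =1 f'.

Definition is_envelope : Prop :=
  is_preenvelope /\
  forall h : {linear P -> P}, f =1 h \o f -> bijective h.

Definition unique_mapping_property : Prop :=
  forall P' : lmodType R, C P' -> forall f' : {linear M -> P'},
  exists g : {linear P -> P'}, f' =1 g \o f /\
  forall g' : {linear P -> P'}, f' =1 g' \o f -> g' =1 g.

End Envelopes.

(* Main.v *)
Require Import Defs.
From HB Require Import structures.
From mathcomp Require Import all_boot all_algebra ring.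
From mathcomp Require Import boolp classical_sets functions.

(** Write R_m for the localization of R at a maximal ideal m.

    If R is von Neumann regular, every element of m dies in R_m, because
    a = a x a makes 1 - x a an element outside m that kills a.  Baer's
    extension argument then shows that every R_m-module is an injective
    R-module ([vnr_baer_criterion], [vnr_Ext1_eq0]).  So every module is almost
    projective, and the identity of M is an envelope of M.

    Conversely, assume that all envelopes exist.  A class that is reflective in
    this sense is stable under limits, up to retracts: the kernel of a map
    between almost projective modules, and any power of an almost projective
    module, is a retract of its own envelope ([unique_mapping_kernel],
    [unique_mapping_power]).  Since R is projective, this applies to the
    annihilator Ann(a) of any a in R and to the countable power R^N.

    Almost projectivity of Q is exploited one maximal ideal at a time: the
    vanishing of Ext^1(Q, -) on R_m-modules yields a dual basis of Q at m, that
    is elements e_j of Q and R-linear maps c_j : Q -> R_m, finitely many of them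
    nonzero at any given x, with f(x) = sum_j c_j(x) f(e_j) for every R-linear
    map f : Q -> R_m ([almost_projective_dual_basis]).  This says that the
    localization of Q at m is a direct summand of a free R_m-module, but needs
    no localization of modules.  Dual bases are inherited by retracts.

    Two consequences make R_m a field.
    - A dual basis of Ann(a) at m forces a to be zero or regular in R_m
      ([localization_annihilator]): if Ann(a) does not vanish at m then some
      c_j(e_j) is a unit of the local ring R_m, while
      a c_j(e_j) = c_j(a e_j) = 0.
    - A dual basis of R^N at m forbids that an element a of m be regular in R_m
      ([countable_power_no_dual_basis]).  This is an argument in the style of
      Chase: a suitable sequence sum_n a^n delta_(k_n) has infinitely many
      nonzero coordinates.  The required k_n exist because, modulo a, the unit
      sequences delta_k are independent and cannot all be expressed by a finite
      part of the dual basis ([coordinate_off]).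
    So each a in m vanishes in R_m, and a ring all of whose localizations at
    maximal ideals are fields is von Neumann regular
    ([von_neumann_von_neumann_regular_of_local_fields]). *)

Set Implicit Arguments.
Unset Strict Implicit.
Unset Printing Implicit Defensive.

Import GRing.Theory.

Local Open Scope classical_set_scope.
Local Open Scope ring_scope.

(** * Submodules and linear maps *)

Definition linear_map_of (R : comPzRingType) (A B : lmodType R) (f : A -> B)
    (fL : linear f) : {linear A -> B} :=
  HB.pack f (GRing.isLinear.Build R A B *:%R f fL).

Definition eval_at (R : comPzRingType) (X : Type) (V : lmodType R) (i : X) :
    {linear (X -> V) -> V} :=
  linear_map_of (fun a x y => erefl : (a *: x + y) i = a *: x i + y i).

Section Submodules.
Variables (R : comPzRingType) (V : lmodType R).

Definition is_submodule (W : set V) : Prop :=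
  [/\ W 0,
      forall x y, W x -> W y -> W (x + y)
    & forall a x, W x -> W (a *: x)].

(** The proof that [W] is a submodule is a phantom argument, which lets the
    module structure be found from the type alone. *)
Definition submodule (W : set V) of is_submodule W := {x : V | x \in W}.

Variables (W : set V) (subW : is_submodule W).

HB.instance Definition _ := SubChoice.on (submodule subW).

Lemma submodule_closed_subproof : subsemimod_closed (fun x => x \in W).
Proof.
have [W0 WD WZ] := subW; split.
  by split; [exact/mem_set | move=> x y /set_mem Wx /set_mem Wy; exact/mem_set/WD].
by move=> a x /set_mem Wx; exact/mem_set/WZ.
Qed.

HB.instance Definition _ :=
  GRing.SubChoice_isSubLmodule.Build R V _ (submodule subW)
    submodule_closed_subproof.

Definition in_submodule (x : V) (Wx : W x) : submodule subW :=
  exist _ x (mem_set Wx).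

Lemma submoduleP (x : submodule subW) : W (val x).
Proof. exact/set_mem/valP. Qed.

Definition submodule_incl : {linear submodule subW -> V} := val.

Lemma is_submoduleB x y : W x -> W y -> W (x - y).
Proof.
by have [_ WD WZ] := subW => Wx Wy; rewrite -scaleN1r; exact/WD/WZ.
Qed.

End Submodules.

Lemma is_submodule_ker (R : comPzRingType) (A B : lmodType R)
  (p : {linear A -> B}) : is_submodule [set x | p x = 0].
Proof.
split=> [|x y /= px py|a x /= px]; first exact: linear0.
  by rewrite linearD px py addr0.
by rewrite linearZZ px scaler0.
Qed.

Definition kernel (R : comPzRingType) (A B : lmodType R) (p : {linear A -> B})
  : lmodType R := submodule (is_submodule_ker p).

Definition kernel_incl (R : comPzRingType) (A B : lmodType R)
    (p : {linear A -> B}) : {linear kernel p -> A} :=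
  submodule_incl (is_submodule_ker p).

(** One form of Zorn's lemma that serves twice.  With [Bad] the singleton of 1
    it produces maximal ideals; with [Bad] the pairs (0, n), n nonzero, the
    submodules of a product A * N that avoid it are the graphs of partial linear
    maps from A to N, and it produces maximal extensions of such maps. *)
Lemma maximal_submodule_avoiding (R : comPzRingType) (V : lmodType R)
    (W0 Bad : set V) : is_submodule W0 -> (forall x, W0 x -> ~ Bad x) ->
  exists W, [/\ is_submodule W, W0 `<=` W, forall x, W x -> ~ Bad x
    & forall W', is_submodule W' -> W `<=` W' -> (forall x, W' x -> ~ Bad x) ->
        W' `<=` W].
Proof.
move=> sub0 bad0.
pose good W := [/\ is_submodule W, W0 `<=` W & forall x, W x -> ~ Bad x].
(* The empty set is added because it is the union of the empty chain. *)
have [|W [goodW maxW]] := @Zorn_bigcup _ [set W | W = set0 \/ good W].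
  move=> F Fgood Ftot /=.
  have [[W1 [FW1 goodW1]]|Fempty] := pselect (exists W, F W /\ good W); last first.
    left; apply/seteqP; split=> // x [W FW Wx].
    have [W00|goodW] := Fgood _ FW; first by rewrite W00 in Wx.
    by case: Fempty; exists W.
  right; have [[W10 _ _] W01 _] := goodW1.
  have subF W x : F W -> W x -> is_submodule W.
    by move=> /Fgood[-> //|[]].
  split; last 2 first.
  - by move=> x /W01 W1x; exists W1.
  - by move=> x [W /Fgood[-> //|[_ _ badW]] /badW].
  split; first by exists W1.
  - move=> x y [X FX Xx] [Y FY Yy].
    have [XY|YX] := Ftot _ _ FX FY.
      by exists Y => //; have [_ YD _] := subF _ _ FY Yy; apply: YD => //; exact: XY.
    by exists X => //; have [_ XD _] := subF _ _ FX Xx; apply: XD => //; exact: YX.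
  - move=> a x [X FX Xx]; exists X => //.
    by have [_ _ XZ] := subF _ _ FX Xx; exact: XZ.
have [W00 _ _] := sub0.
case: goodW => [W_0|[subW W0W badW]].
  exfalso; apply: (maxW W0); last by right; split.
  by rewrite W_0; split=> [x []|/(_ _ W00)].
exists W; split=> // W' subW' WW' badW' x W'x.
apply: contrapT => nWx; apply: (maxW W'); last first.
  by right; split=> //; exact: subset_trans WW'.
by split=> // /(_ _ W'x).
Qed.

(** * Free modules and free resolutions *)

Section FreeModule.
Variables (R : comPzRingType) (X : choiceType).

Definition finitely_supported : set (X -> R^o) :=
  [set v | exists s : seq X, forall x, v x != 0 -> x \in s].

Lemma is_submodule_finitely_supported : is_submodule finitely_supported.
Proof.
split=> [|v w [s vs] [t wt]|a v [s vs]].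
- by exists [::] => x; rewrite eqxx.
- exists (s ++ t) => x vwx; rewrite mem_cat; apply: contraT.
  rewrite negb_or => /andP[xs xt].
  have /eqP vx : v x == 0 by apply: contraNT xs; exact: vs.
  have /eqP wx : w x == 0 by apply: contraNT xt; exact: wt.
  by move: vwx; rewrite (_ : (v + w) x = v x + w x) // vx wx addr0 eqxx.
- exists s => x avx; apply: vs; apply: contraNneq avx => vx.
  by rewrite (_ : (a *: v) x = a *: v x) // vx scaler0.
Qed.

Definition free_module : lmodType R := submodule is_submodule_finitely_supported.

Definition coef (v : free_module) : X -> R := val v.

Lemma coef_inj (v w : free_module) : coef v =1 coef w -> v = w.
Proof. by move=> vw; apply/val_inj/funext. Qed.

Lemma coefD v w x : coef (v + w) x = coef v x + coef w x.
Proof. by []. Qed.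

Lemma coefZ a v x : coef (a *: v) x = a * coef v x.
Proof. by []. Qed.

Lemma basis_finitely_supported x :
  finitely_supported (fun y => (y == x)%:R : R^o).
Proof.
exists [:: x] => y; rewrite inE; by case: (eqVneq y x) => // _; rewrite eqxx.
Qed.

Definition basis (x : X) : free_module :=
  in_submodule is_submodule_finitely_supported (basis_finitely_supported x).

Lemma coef_basis x y : coef (basis x) y = (y == x)%:R.
Proof. by []. Qed.

(** A duplicate-free list that contains the support, possibly with extra
    elements; [basis_extE] shows that the choice is immaterial in sums. *)
Definition support (v : free_module) : seq X :=
  undup (sval (cid (submoduleP v))).

Lemma support_uniq v : uniq (support v).
Proof. exact: undup_uniq. Qed.

Lemma mem_support v x : coef v x != 0 -> x \in support v.
Proof. by rewrite mem_undup; move: x; exact: svalP (cid (submoduleP v)). Qed.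

Section Extension.
Variables (V : lmodType R) (phi : X -> V).

Definition basis_ext (v : free_module) : V :=
  \sum_(x <- support v) coef v x *: phi x.

(** Any duplicate-free list that covers the support computes the sum, so that
    the sums attached to several elements can be taken over a common list. *)
Lemma basis_extE v (s : seq X) : uniq s ->
    (forall x, coef v x != 0 -> x \in s) ->
  basis_ext v = \sum_(x <- s) coef v x *: phi x.
Proof.
move=> us vs; rewrite /basis_ext.
have filterE t : \sum_(x <- t) coef v x *: phi x =
    \sum_(x <- [seq x <- t | coef v x != 0]) coef v x *: phi x.
  rewrite big_filter [RHS]big_mkcond; apply: eq_bigr => x _.
  by case: eqVneq => //= ->; rewrite scale0r.
rewrite filterE [RHS]filterE; apply: perm_big; apply: uniq_perm.
- exact/filter_uniq/support_uniq.
- exact: filter_uniq.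
move=> x; rewrite !mem_filter; case: (boolP (coef v x != 0)) => //= vx.
by rewrite mem_support // vs.
Qed.

Lemma basis_ext_is_linear : linear basis_ext.
Proof.
move=> a v w; pose s := undup (support v ++ support w).
have us : uniq s by exact: undup_uniq.
have sv x : coef v x != 0 -> x \in s.
  by move=> vx; rewrite mem_undup mem_cat mem_support.
have sw x : coef w x != 0 -> x \in s.
  by move=> wx; rewrite mem_undup mem_cat (mem_support wx) orbT.
rewrite (basis_extE us sv) (basis_extE us sw) (@basis_extE _ s us).
  rewrite scaler_sumr -big_split; apply: eq_bigr => x _ /=.
  by rewrite coefD coefZ scalerDl scalerA.
move=> x; apply: contraNT => xs.
have /eqP vx : coef v x == 0 by apply: contraNT xs; exact: sv.
have /eqP wx : coef w x == 0 by apply: contraNT xs; exact: sw.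
by rewrite coefD coefZ vx wx mulr0 addr0.
Qed.

Definition basis_ext_linear : {linear free_module -> V} :=
  linear_map_of basis_ext_is_linear.

Lemma basis_ext_basis x : basis_ext (basis x) = phi x.
Proof.
rewrite (@basis_extE _ [:: x]) //; last first.
  by move=> y; rewrite coef_basis inE; case: (eqVneq y x) => // _; rewrite eqxx.
by rewrite big_seq1 coef_basis eqxx scale1r.
Qed.

End Extension.

Lemma linear_basis_ext (V W : lmodType R) (g : {linear V -> W}) phi v :
  g (basis_ext phi v) = basis_ext (g \o phi) v.
Proof.
by rewrite linear_sum; apply: eq_bigr => x _; rewrite linearZ.
Qed.

Lemma basis_ext_id v : basis_ext basis v = v.
Proof.
apply: coef_inj => y.
rewrite /basis_ext /coef [val _]raddf_sum fct_sumE.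
have [ys|ys] := boolP (y \in support v).
  rewrite (bigD1_seq y) ?support_uniq //= big1 => [|x xy].
    by rewrite [LHS]addr0 [LHS]mulr_natr /= eqxx.
  by rewrite [LHS]mulr_natr eq_sym (negbTE xy).
rewrite big_seq big1 => [|x xs].
  by apply/esym/eqP; apply: contraNT ys; exact: mem_support.
rewrite [LHS]mulr_natr; case: eqVneq => // yx.
by rewrite yx xs in ys.
Qed.

Lemma free_module_ext (V : lmodType R) (g : {linear free_module -> V}) v :
  g v = basis_ext (g \o basis) v.
Proof. by rewrite -{1}(basis_ext_id v) linear_basis_ext. Qed.

Lemma free_module_projective : projective free_module.
Proof.
move=> A B p f surjp.
pose lift x := sval (cid (surjp (f (basis x)))).
exists (basis_ext_linear lift) => v /=.
rewrite linear_basis_ext free_module_ext; congr basis_ext; apply/funext => x /=.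
by rewrite /lift; case: cid.
Qed.

End FreeModule.

Definition free_cover (R : comPzRingType) (M : lmodType R) :
    {linear free_module R M -> M} :=
  basis_ext_linear id.

Lemma free_cover_surj (R : comPzRingType) (M : lmodType R) :
  surjective_fun (free_cover M).
Proof. by move=> x; exists (basis R x); rewrite /= basis_ext_basis. Qed.

Section FreeResolution.
Variables (R : comPzRingType) (M : lmodType R).

(** Taking kernels of the canonical free covers again and again: the n-th term
    of the resolution is free on the underlying set of the n-th syzygy. *)
Fixpoint syzygy n : lmodType R :=
  if n is n'.+1 then kernel (free_cover (syzygy n')) else M.

Definition syzygy_diff n :
    {linear free_module R (syzygy n.+1) -> free_module R (syzygy n)} :=
  kernel_incl (free_cover (syzygy n)) \o free_cover (syzygy n.+1).

Lemma syzygy_diff_image n x :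
  free_cover (syzygy n) x = 0 <-> exists y, syzygy_diff n y = x.
Proof.
split=> [x0|[y <-]].
  have [y yx] := @free_cover_surj R (syzygy n.+1)
    (in_submodule (is_submodule_ker (free_cover (syzygy n))) x0).
  by exists y; rewrite /syzygy_diff [LHS]/= [basis_ext _ _]yx.
exact: (submoduleP (free_cover (syzygy n.+1) y)).
Qed.

Lemma syzygy_exact n x :
  syzygy_diff n x = 0 <-> exists y, syzygy_diff n.+1 y = x.
Proof.
rewrite -syzygy_diff_image; split=> [x0|x0]; first exact: val_inj.
by rewrite /syzygy_diff /= [basis_ext _ _]x0.
Qed.

Definition free_resolution : projective_resolution M :=
  @Build_projective_resolution R M (fun n => free_module R (syzygy n))
    syzygy_diff (free_cover M) (fun n => @free_module_projective R (syzygy n))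
    (@free_cover_surj R M) (@syzygy_diff_image 0) syzygy_exact.

(** How a vanishing Ext^1 is used: composed with the free cover of the kernel, a
    map out of the kernel becomes a 1-cocycle of the free resolution, and a
    1-cochain that bounds it extends the map. *)
Lemma Ext1_eq0_extension (N : lmodType R) : Ext1_eq0 M N ->
  forall g : {linear kernel (free_cover M) -> N},
  exists h : {linear free_module R M -> N},
    forall k, h (kernel_incl (free_cover M) k) = g k.
Proof.
move=> extN g.
have [x|h hE] := extN free_resolution (g \o free_cover (syzygy 1)).
  rewrite /= [basis_ext _ _](_ : _ = 0) ?linear0 //.
  exact: (submoduleP (free_cover (syzygy 2) x)).
exists h => k; have [y <-] := free_cover_surj k.
by have := hE y; rewrite /= => ->.
Qed.

End FreeResolution.

(** * Restriction of scalars and relative dual bases *)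

Section RestrictedMaps.
Variables (R S : comPzRingType) (phi : {rmorphism R -> S}).
Local Notation restricted N := (restrict_scalars phi N).

Lemma rmorphism_is_linear : linear (phi : R^o -> restricted S^o).
Proof. by move=> a x y; rewrite rmorphD rmorphM. Qed.

Definition rmorphism_linear : {linear R^o -> restricted S^o} :=
  linear_map_of rmorphism_is_linear.

Section Restrict.
Variables (V W : lmodType S) (f : {linear V -> W}).

Definition restrict_fun (x : restricted V) : restricted W := f x.

Lemma restrict_fun_is_linear : linear restrict_fun.
Proof. by move=> a x y; exact: (linearP f (phi a)). Qed.

Definition restrict_linear : {linear restricted V -> restricted W} :=
  linear_map_of restrict_fun_is_linear.

End Restrict.

Section Corestrict.
Variables (A : lmodType R) (V : lmodType S) (W : set V).
Variables (subW : is_submodule W) (f : {linear A -> restricted V}).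
Hypothesis fW : forall x, W (f x).

Definition corestrict_fun x : restricted (submodule subW) :=
  in_submodule subW (fW x).

Lemma corestrict_fun_is_linear : linear corestrict_fun.
Proof. by move=> a x y; apply: val_inj; exact: (linearP f). Qed.

Definition corestrict : {linear A -> restricted (submodule subW)} :=
  linear_map_of corestrict_fun_is_linear.

End Corestrict.

Section ExtendCoef.
Variable X : choiceType.

Lemma extend_coef_finitely_supported (v : free_module R X) :
  finitely_supported (fun x => phi (coef v x) : S^o).
Proof.
exists (support v) => x; rewrite -[_ != 0]/(phi _ != 0) => vx; apply: mem_support.
by apply: contraNneq vx => ->; rewrite rmorph0.
Qed.

(** The canonical map from R^(X) to its base change S^(X). *)
Definition extend_coef (v : free_module R X) : free_module S X :=
  in_submodule (is_submodule_finitely_supported S X)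
    (extend_coef_finitely_supported v).

Lemma coef_extend_coef v x : coef (extend_coef v) x = phi (coef v x).
Proof. by []. Qed.

Lemma extend_coefP a v w :
  extend_coef (a *: v + w) = phi a *: extend_coef v + extend_coef w.
Proof.
apply: coef_inj => x; rewrite coefD coefZ !coef_extend_coef coefD coefZ.
by rewrite rmorphD rmorphM.
Qed.

Lemma extend_coef_is_linear :
  linear (extend_coef : _ -> restricted (free_module S X)).
Proof. exact: extend_coefP. Qed.

Definition extend_coef_linear :
    {linear free_module R X -> restricted (free_module S X)} :=
  linear_map_of extend_coef_is_linear.

Lemma extend_coefZ a v : extend_coef (a *: v) = phi a *: extend_coef v.
Proof. exact: (linearZZ extend_coef_linear). Qed.

Lemma extend_coefD v w : extend_coef (v + w) = extend_coef v + extend_coef w.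
Proof. exact: (linearD extend_coef_linear). Qed.

Lemma extend_coef0 : extend_coef 0 = 0.
Proof. exact: (linear0 extend_coef_linear). Qed.

Lemma basis_ext_extend_coef (V : lmodType R) (f : {linear V -> restricted S^o})
    (e : X -> V) v :
  basis_ext (fun x => f (e x) : S^o) (extend_coef v) = f (basis_ext e v).
Proof.
rewrite linear_sum (basis_extE _ (support_uniq v)) => [|x vx].
  by apply: eq_bigr => x _; rewrite linearZ.
apply: mem_support; apply: contraNneq vx => vx.
by rewrite coef_extend_coef vx rmorph0.
Qed.

End ExtendCoef.

(** A dual basis for the base change of [A] along [phi], expressed without
    tensor products: an S-linear map from the base change to S is the same as an
    R-linear map from [A] to S. *)
Definition is_dual_basis_along (A : lmodType R) (J : choiceType) (e : J -> A)
    (c : {linear A -> restricted (free_module S J)}) : Prop :=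
  forall (f : {linear A -> restricted S^o}) x,
    f x = basis_ext (fun j => f (e j) : S^o) (c x).

Definition has_dual_basis_along (A : lmodType R) : Prop :=
  exists (J : choiceType) (e : J -> A)
         (c : {linear A -> restricted (free_module S J)}),
    is_dual_basis_along e c.

Lemma has_dual_basis_along_retract (A Q : lmodType R) (i : {linear A -> Q})
    (r : {linear Q -> A}) : cancel i r ->
  has_dual_basis_along Q -> has_dual_basis_along A.
Proof.
move=> ir [J [e [c cP]]]; exists J, (r \o e), (c \o i) => f x.
by rewrite -[in LHS](ir x); exact: (cP (f \o r)).
Qed.

Section Coordinates.
Variables (A : lmodType R) (J : choiceType).
Variable c : {linear A -> restricted (free_module S J)}.

Definition coordinate (x : A) (j : J) : S := coef (c x : free_module S J) j.

Lemma coordinateD x y j : coordinate (x + y) j = coordinate x j + coordinate y j.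
Proof. by rewrite /coordinate linearD. Qed.

Lemma coordinateZ a x j : coordinate (a *: x) j = phi a * coordinate x j.
Proof. by rewrite /coordinate linearZZ. Qed.

Lemma coordinate0 j : coordinate 0 j = 0.
Proof. by rewrite /coordinate linear0. Qed.

End Coordinates.

End RestrictedMaps.

(** * Localization at a maximal ideal *)

Section LocalRing.
Variables (R : comPzRingType) (m : maximal_ideal R).
Local Notation D := (localization_at m).
Local Notation tau := (to_localization_at m).

(** Together with the next two lemmas, all that is used about fractions: which
    elements of R vanish, that denominators can be cleared, and that elements
    outside [m] become invertible. *)
Lemma localization_eq0 (a : R) : tau a = 0 <-> exists2 u, ~ m u & u * a = 0.
Proof.
split=> [/Localization.fracP[u mu /=]|[u mu ua0]].
  by rewrite !mulr1 mulr0 => ua0; exists u.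
apply/Localization.fracP; exists u => //=.
by rewrite !mulr1 mulr0.
Qed.

Lemma localization_num (d : D) : exists a s, ~ m s /\ tau s * d = tau a.
Proof.
elim/Localization.frac_ind: d => -[a s ms]; exists a, s; split=> //.
rewrite -[LHS]/(Localization.mul (Localization.frac _) (Localization.frac _)).
by rewrite Localization.fracM; apply: Localization.frac_eq => /=; ring.
Qed.

Lemma localization_inv (s : R) : ~ m s -> exists d : D, d * tau s = 1.
Proof.
move=> ms.
exists (Localization.frac (@Localization.Ratio R (maximal_compl m) 1 s ms)).
rewrite -[LHS]/(Localization.mul (Localization.frac _) (Localization.frac _)).
by rewrite Localization.fracM; apply: Localization.frac_eq => /=; ring.
Qed.

Lemma localization_cancel (V : lmodType D) s (x : V) :
  ~ m s -> tau s *: x = 0 -> x = 0.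
Proof.
move=> /localization_inv[d ds1] sx0.
by rewrite -[x]scale1r -ds1 -scalerA sx0 scaler0.
Qed.

(** The maximal ideal of the local ring [D]. *)
Definition localized_maximal : set D :=
  [set d | exists x s, [/\ m x, ~ m s & tau s * d = tau x]].

Lemma localized_maximal_tau x : m x -> localized_maximal (tau x).
Proof.
by exists x, 1; split=> //; [exact: maximal_compl1 | rewrite rmorph1 mul1r].
Qed.

Lemma localized_maximal0 : localized_maximal 0.
Proof.
by rewrite -(rmorph0 tau); apply: localized_maximal_tau; case: (maxidealP m) => -[].
Qed.

Lemma localized_maximalD d d' :
  localized_maximal d -> localized_maximal d' -> localized_maximal (d + d').
Proof.
have [[m0 mD mM] _ _] := maxidealP m.
move=> [x [s [mx ms sx]]] [y [t [my mt ty]]].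
exists (t * x + s * y), (s * t); split; last 2 first.
- exact: maximal_complM.
- by rewrite rmorphD !rmorphM -sx -ty; ring.
exact/mD/mM/my/mM.
Qed.

Lemma localized_maximalM d d' : localized_maximal d -> localized_maximal (d' * d).
Proof.
have [[m0 mD mM] _ _] := maxidealP m.
move=> [x [s [mx ms sx]]]; have [a [t [mt ta]]] := localization_num d'.
exists (a * x), (s * t); split; [exact: mM | exact: maximal_complM | ].
by rewrite !rmorphM -sx -ta; ring.
Qed.

Lemma localized_maximal1 : ~ localized_maximal 1.
Proof.
have [[m0 mD mM] _ _] := maxidealP m.
move=> [x [s [mx ms]]]; rewrite mulr1 => sx.
have /localization_eq0[u mu usx] : tau (s - x) = 0 by rewrite rmorphB sx subrr.
apply: (maximal_complM mu ms).
by rewrite -[u * s](subrK (u * x)) -mulrBr usx add0r; exact: mM.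
Qed.

Lemma localized_unit d : ~ localized_maximal d -> exists d', d' * d = 1.
Proof.
have [a [s [ms sd]]] := localization_num d => nd.
have /localization_inv[d' d'a] : ~ m a by move=> ma; apply: nd; exists a, s.
by exists (d' * tau s); rewrite -mulrA sd.
Qed.

End LocalRing.

Section LocalDualBases.
Variables (R : comPzRingType) (m : maximal_ideal R).
Local Notation D := (localization_at m).
Local Notation tau := (to_localization_at m).
Local Notation restricted N := (restrict_scalars tau N).

Section LocalizedKernel.
Variables (X : choiceType) (V : lmodType R) (p : {linear free_module R X -> V}).

(** The D-span of the image of ker p in D^(X), a D-module even though ker p is
    only an R-module. *)
Definition localized_kernel : set (free_module D X) :=
  [set v | exists s k, [/\ ~ m s, p k = 0 & tau s *: v = extend_coef tau k]].

Lemma is_submodule_localized_kernel : is_submodule localized_kernel.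
Proof.
split=> [|v w [s [k [ms pk sv]]] [t [l [mt pl tw]]]|d v [s [k [ms pk sv]]]].
- exists 1, 0; split; [exact: maximal_compl1 | exact: linear0 |].
  by rewrite scaler0 extend_coef0.
- exists (s * t), (t *: k + s *: l); split; first exact: maximal_complM.
    by rewrite linearD !linearZZ pk pl !scaler0 addr0.
  rewrite extend_coefD !extend_coefZ -sv -tw !scalerA scalerDr -!rmorphM.
  by rewrite [t * s]mulrC.
- have [a [t [mt ta]]] := localization_num d.
  exists (s * t), (a *: k); split; first exact: maximal_complM.
    by rewrite linearZZ pk scaler0.
  by rewrite extend_coefZ -sv -ta !scalerA rmorphM; congr (_ *: _); ring.
Qed.

End LocalizedKernel.

(** Let F be the free module on Q, p : F -> Q the canonical cover, and N the
    D-span of ker p in the free D-module on Q.  Since N is a D-module, the map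
    ker p -> N extends to h : F -> N.  The difference s of F -> D^(Q) and h
    kills ker p, so it induces a linear map c : Q -> D^(Q).  For f : Q -> D the
    D-linear extension of f to D^(Q) kills N, hence takes at c(x) the same value
    as at the basis vector of x, namely f(x). *)
Lemma almost_projective_dual_basis (Q : lmodType R) :
  almost_projective Q -> has_dual_basis_along tau Q.
Proof.
move=> apQ; pose p := free_cover Q.
pose subN := is_submodule_localized_kernel p.
pose loc : {linear free_module R Q -> _} := extend_coef_linear tau Q.
have locN (k : kernel p) : localized_kernel p ((loc \o kernel_incl p) k).
  exists 1, (val k); split; [exact: maximal_compl1 | exact: (submoduleP k) |].
  by rewrite rmorph1 scale1r.
have [h hE] := Ext1_eq0_extension (apQ m (submodule subN)) (corestrict subN locN).
pose incl := submodule_incl subN.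
pose s : {linear free_module R Q -> restricted (free_module D Q)} :=
  loc \- (restrict_linear tau incl \o h).
have s_ker v : p v = 0 -> s v = 0.
  move=> pv0; apply/eqP; rewrite subr_eq0; apply/eqP.
  pose k : kernel p := in_submodule (is_submodule_ker p) pv0.
  exact: esym (congr1 incl (hE k)).
pose c x := s (basis R x).
have cL : linear c.
  move=> a x y; apply/eqP; rewrite -subr_eq0 -linearP -linearB.
  apply/eqP/s_ker.
  by rewrite linearB linearP /= !basis_ext_basis subrr.
exists Q, id, (linear_map_of cL) => phi x.
pose ext := basis_ext_linear (fun j => phi j : D^o).
have phi0 (n : submodule subN) : ext (incl n) = 0.
  have [t [k [mt pk tn]]] := submoduleP n.
  apply: (localization_cancel mt); rewrite -(linearZZ ext) tn.
  rewrite [LHS]basis_ext_extend_coef.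
  by rewrite -[basis_ext id k]/(p k) pk linear0.
rewrite -[RHS]/(ext (extend_coef tau (basis R x) - incl (h (basis R x)))).
by rewrite (linearB ext) phi0 subr0 [RHS]basis_ext_extend_coef basis_ext_basis.
Qed.

End LocalDualBases.

(** * Congruences modulo a principal ideal *)

Section Congruence.
Variable S : comPzRingType.
Implicit Types p x y : S.

Definition congr_mod p x y : Prop := exists d, x - y = p * d.

Lemma congr_mod_refl p x : congr_mod p x x.
Proof. by exists 0; rewrite subrr mulr0. Qed.

Lemma congr_modD p x x' y y' :
  congr_mod p x x' -> congr_mod p y y' -> congr_mod p (x + y) (x' + y').
Proof.
move=> [d xd] [f yf]; exists (d + f).
by rewrite mulrDr -xd -yf opprD addrACA.
Qed.

Lemma congr_modM p x x' y y' :
  congr_mod p x x' -> congr_mod p y y' -> congr_mod p (x * y) (x' * y').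
Proof.
move=> [d xd] [f yf]; exists (x * f + d * y').
by rewrite mulrDr mulrCA -yf mulrA -xd; ring.
Qed.

(** The determinant is a polynomial in the entries. *)
Lemma congr_mod_det p n (A B : 'M[S]_n) :
  (forall i j, congr_mod p (A i j) (B i j)) -> congr_mod p (\det A) (\det B).
Proof.
move=> AB; rewrite /determinant.
elim/big_ind2: _ => [|? ? ? ?|s _]; [exact: congr_mod_refl | exact: congr_modD |].
apply: congr_modM; first exact: congr_mod_refl.
by elim/big_ind2: _ => [|? ? ? ?|i _]; [exact: congr_mod_refl | exact: congr_modM |].
Qed.

Lemma det_mulmx_thin n (B : 'M[S]_(n + 1, n)) (C : 'M[S]_(n, n + 1)) :
  \det (B *m C) = 0.
Proof.
have -> : B *m C = row_mx B 0 *m col_mx C (0 : 'M_(1, n + 1)).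
  by rewrite mul_row_col mulmx0 addr0.
rewrite det_mulmx (expand_det_col (row_mx B 0) (rshift n ord0)).
by rewrite big1 ?mul0r // => i _; rewrite row_mxEr mxE mul0r.
Qed.

(** Rank obstruction over an arbitrary commutative ring: if the identity of size
    n + 1 factors through size n modulo [p], then 1 is a multiple of [p]. *)
Lemma congr01_of_thin_factorization p n (B : 'M[S]_(n + 1, n))
    (C : 'M[S]_(n, n + 1)) :
  (forall i j, congr_mod p ((B *m C) i j) ((i == j)%:R)) -> congr_mod p 0 1.
Proof.
move=> BC; rewrite -(det_mulmx_thin B C) -(det1 S (n + 1)).
by apply: congr_mod_det => i j; rewrite [1%:M i j]mxE; exact: BC.
Qed.

End Congruence.

(** * Annihilators *)

Definition scaling (R : comPzRingType) (a : R) : {linear R^o -> R^o} :=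
  GRing.scale a.

Section Annihilators.
Variables (R : comPzRingType) (m : maximal_ideal R).
Local Notation D := (localization_at m).
Local Notation tau := (to_localization_at m).

(** If a is not regular in D, some z in Ann(a) is nonzero in D.  In
    z = sum_j c_j(z) e_j each term equals z c_j(e_j), because
    c_j(z) e_j = c_j(e_j z) = z c_j(e_j).  Hence z (1 - t) = 0 with
    t = sum_j c_j(e_j).  As D is local and z is nonzero, t is a unit and so is
    some c_j(e_j); but a c_j(e_j) = c_j(a e_j) = 0. *)
Lemma localization_annihilator (a : R) :
  has_dual_basis_along tau (kernel (scaling a)) ->
  tau a = 0 \/ (forall d : D, tau a * d = 0 -> d = 0).
Proof.
move=> [J [e [c cP]]].
case: (pselect (forall d : D, tau a * d = 0 -> d = 0)) => [|nreg]; first by right.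
left.
have [d [ad0 d0]] : exists d, tau a * d = 0 /\ d <> 0.
  apply: contrapT => no; apply: nreg => d ad0; apply: contrapT => d0.
  by apply: no; exists d.
have [b [s [ms sd]]] := localization_num d.
have /localization_eq0[u mu uab] : tau (a * b) = 0.
  by rewrite rmorphM -sd mulrCA ad0 mulr0.
have az0 : scaling a (u * b) = 0.
  by rewrite -uab /=; rewrite -[_ *: _]/(a * (u * b)) mulrCA.
pose z : kernel (scaling a) := in_submodule (is_submodule_ker (scaling a)) az0.
have zE : tau (u * b) = tau u * tau s * d by rewrite rmorphM -mulrA sd.
have z0 : tau (val z) <> 0.
  move=> /= ub0; apply: d0.
  apply: (localization_cancel (V := D^o) (maximal_complM mu ms)).
  by rewrite -[LHS]/(tau (u * s) * d) rmorphM -zE.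
pose incl : {linear kernel (scaling a) -> restrict_scalars tau D^o} :=
  rmorphism_linear tau \o kernel_incl (scaling a).
pose t := \sum_(j <- support (c z)) coordinate c (e j) j.
have tz : tau (val z) * t = tau (val z).
  rewrite -[RHS]/(incl z) (cP incl z) mulr_sumr; apply: eq_bigr => j _.
  rewrite -coordinateZ -[RHS]/(coordinate c z j * tau (val (e j))).
  rewrite mulrC -coordinateZ.
  congr (coordinate c _ j); apply: val_inj.
  exact: (mulrC (val z : R) (val (e j) : R)).
have nt : ~ localized_maximal t.
  move=> mt; have [] := @localized_unit _ m (1 - t).
    move=> m1t; apply: (@localized_maximal1 _ m).
    by rewrite -(subrK t 1); exact: localized_maximalD.
  move=> v v1; apply: z0; rewrite -[LHS]mul1r -v1 -mulrA mulrBl mul1r.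
  by rewrite [t * _]mulrC tz subrr mulr0.
have [j nj] : exists j, ~ localized_maximal (coordinate c (e j) j).
  apply: contrapT => no; apply: nt; rewrite /t.
  elim/big_ind: _ => [|x y|j _]; first exact: localized_maximal0.
    exact: localized_maximalD.
  by apply: contrapT => nj; apply: no; exists j.
have [v v1] := localized_unit nj.
rewrite -[LHS]mulr1 -v1 mulrCA -coordinateZ.
rewrite [a *: e j](_ : _ = 0); last by apply: val_inj; exact: (submoduleP (e j)).
by rewrite coordinate0 mulr0.
Qed.

Lemma nonunit_mod_maximal a : m a -> ~ congr_mod (tau a) 0 1.
Proof.
move=> ma [d ad]; apply: (@localized_maximal1 _ m).
have -> : 1 = - d * tau a by rewrite mulNr mulrC -ad sub0r opprK.
exact/localized_maximalM/localized_maximal_tau.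
Qed.

End Annihilators.

(** * Countable powers of the ring *)

Section ChangeOfRings.
Variables (R S : comPzRingType) (phi : {rmorphism R -> S}).
Local Notation restricted N := (restrict_scalars phi N).

Local Notation A := (nat -> R^o).
Local Notation delta k := ((fun i => (i == k)%:R) : A).
Variable a : R.
Hypothesis nonunit_a : ~ congr_mod (phi a) 0 1.
Hypothesis reg_a : forall d, phi a * d = 0 -> d = 0.

(** Suppose that, for all k >= b, the coordinates of delta_k outside F are
    divisible by a.  Then, modulo a, the entries of delta_b, delta_(b + 1), ...
    at the positions b, b + 1, ... are computed by the dual basis elements in F
    alone, which factors identity matrices of every size through size |F|. *)
Lemma coordinate_off (J : choiceType) (e : J -> A)
    (c : {linear A -> restricted (free_module S J)}) (F : seq J) (b : nat) :
  is_dual_basis_along e c -> exists kj : nat * J,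
  [/\ (b <= kj.1)%N, kj.2 \notin F
    & ~ congr_mod (phi a) 0 (coordinate c (delta kj.1) kj.2)].
Proof.
move=> cP; apply: contrapT => no.
have cong k j : (b <= k)%N -> j \notin F ->
    congr_mod (phi a) 0 (coordinate c (delta k) j).
  by move=> bk jF; apply: contrapT => nc; apply: no; exists (k, j).
pose G := undup F.
pose B : 'M[S]_(size G + 1, size G) :=
  \matrix_(k, l) coordinate c (delta (b + k)%N) (tnth (in_tuple G) l).
pose C : 'M[S]_(size G, size G + 1) :=
  \matrix_(l, i) phi (e (tnth (in_tuple G) l) (b + i)%N).
apply: nonunit_a; apply: (congr01_of_thin_factorization (B := B) (C := C)) => k i.
rewrite mxE; pose x := delta (b + k)%N.
pose f : {linear A -> restricted S^o} := rmorphism_linear phi \o eval_at R^o (b + i).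
have -> : (k == i)%:R = f x.
  rewrite -[f x]/(phi (b + i == b + k)%:R) eqn_add2l.
  by rewrite [(_ == k :> nat)]eq_sym rmorph_nat.
rewrite (cP f x).
pose H := [seq j <- support (c x) | j \notin G].
(* The indices in F give the matrix product, those in H vanish modulo a. *)
rewrite (@basis_extE _ _ _ _ _ (G ++ H)); last 2 first.
- rewrite cat_uniq undup_uniq filter_uniq ?support_uniq // andbT.
  by apply/hasPn => j; rewrite mem_filter => /andP[].
- move=> j cj; rewrite mem_cat mem_filter; case: (j \in G) => //=.
  exact: mem_support.
rewrite big_cat -[X in congr_mod _ X _]addr0; apply: congr_modD.
  rewrite [X in congr_mod _ _ X](_ : _ = \sum_l B k l * C l i).
    exact: congr_mod_refl.
  by rewrite big_tnth; apply: eq_bigr => l _; rewrite !mxE.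
rewrite big_seq; elim/big_ind: _ => [|u v u0 v0|j].
- exact: congr_mod_refl.
- by rewrite -[X in congr_mod _ X _]addr0; exact: congr_modD.
rewrite mem_filter => /andP[]; rewrite mem_undup => jF _.
rewrite -[X in congr_mod _ X _](mul0r (f (e j) : S)) -[_ *: _]/(_ * _).
apply: congr_modM; last exact: congr_mod_refl.
by apply: cong => //; exact: leq_addr.
Qed.

(** Choose k_0, k_1, ... and j_0, j_1, ... so that c_(j_n)(delta_(k_n)) is not
    divisible by a, while c_(j_n) vanishes at delta_(k_l) for l < n.  For
    x = sum_n a^n delta_(k_n) this gives c_(j_n)(x) = a^n u with u congruent to
    c_(j_n)(delta_(k_n)) modulo a, hence c_(j_n)(x) <> 0 as a is regular.  The
    j_n are pairwise distinct, so x has infinitely many nonzero coordinates. *)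
Lemma countable_power_no_dual_basis : ~ has_dual_basis_along phi A.
Proof.
move=> [J [e [c cP]]].
have [G GP] : exists G : seq J * nat -> nat * J, forall st,
    [/\ (st.2 <= (G st).1)%N, (G st).2 \notin st.1 &
        ~ congr_mod (phi a) 0 (coordinate c (delta (G st).1) (G st).2)].
  exists (fun st => sval (cid (coordinate_off st.1 st.2 cP))) => st.
  exact: svalP (cid (coordinate_off st.1 st.2 cP)).
(* The state records the indices met so far, to be avoided by the next j, and a
   lower bound for the next k, which makes the sequence k strictly increasing. *)
pose st := fix st n : seq J * nat := if n is n'.+1 then
  ((st n').1 ++ support (c (delta (G (st n')).1)), (G (st n')).1.+1)
  else ([::], 0%N).
pose k n := (G (st n)).1; pose j n := (G (st n)).2.
have ncong n : ~ congr_mod (phi a) 0 (coordinate c (delta (k n)) (j n)).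
  by have [] := GP (st n).
have kn n : (n <= k n)%N.
  have: (n <= (st n).2)%N.
    by elim: n => //= n IH; rewrite ltnS (leq_trans IH) //; case: (GP (st n)).
  by move/leq_trans; apply; case: (GP (st n)).
have stS n l : (l < n)%N -> {subset support (c (delta (k l))) <= (st n).1}.
  elim: n => // n IH; rewrite ltnS leq_eqVlt => /predU1P[->|ln] x /= xs.
    by rewrite mem_cat xs orbT.
  by rewrite mem_cat IH.
have off l n : (l < n)%N -> coordinate c (delta (k l)) (j n) = 0.
  move=> ln; apply/eqP; apply: contraT => /mem_support /(stS _ _ ln).
  by have [_ /negbTE -> _] := GP (st n).
have on n : coordinate c (delta (k n)) (j n) != 0.
  by apply/eqP => c0; apply: (ncong n); rewrite c0; exact: congr_mod_refl.
(* The tail sum_(l >= p) a^(l - p) delta_(k_l), so that y 0 is the sequence x.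
   At position i the sum can stop at l = i, because l <= k_l. *)
pose y p : A := fun i => \sum_(p <= l < i.+1 | k l == i) a ^+ (l - p).
have yS p : y p = a *: y p.+1 + delta (k p).
  apply/funext => i; rewrite /y -[RHS]/(a * _ + (i == k p)%:R).
  have [pi|ip] := leqP p i; last first.
    rewrite !big_geq // ?(leqW ip) // mulr0 add0r.
    by case: eqVneq (kn p) => // <-; rewrite leqNgt ip.
  rewrite big_ltn_cond // subnn expr0 mulr_sumr eq_sym addrC.
  have -> : \sum_(p.+1 <= l < i.+1 | k l == i) a ^+ (l - p) =
            \sum_(p.+1 <= l < i.+1 | k l == i) a * a ^+ (l - p.+1).
    rewrite big_nat_cond [RHS]big_nat_cond; apply: eq_bigr => l /andP[/andP[pl _] _].
    by rewrite -exprS -subSn // subSS.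
  by case: eqP => _; rewrite ?addr0.
(* Descending induction from y n to y 0: for l < n, passing from y (l + 1) to
   y l multiplies the coordinate j n by a, which is regular. *)
have coord_y n p : (p <= n)%N -> coordinate c (y (n - p)%N) (j n) != 0.
  elim: p => [_|p IH pn].
    apply/eqP => c0; apply: (ncong n); exists (coordinate c (y n.+1) (j n)).
    by rewrite -c0 subn0 yS coordinateD coordinateZ addrK.
  apply: contra_neq (IH (ltnW pn)); rewrite yS coordinateD coordinateZ.
  rewrite off; last by rewrite ltn_subrL (leq_trans _ pn).
  by rewrite addr0 -subSn // subSS => /reg_a.
have j_supp n : j n \in support (c (y 0%N)).
  by apply: mem_support; rewrite -(subnn n); exact: coord_y.
have j_inj : injective j.
  move=> n n' jj; apply/eqP; case: ltngtP => // lt; exfalso.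
    by have /eqP := on n; rewrite jj; apply; exact: off.
  by have /eqP := on n'; rewrite -jj; apply; exact: off.
pose s := support (c (y 0%N)).
have : (size [seq j n | n <- iota 0 (size s).+1] <= size s)%N.
  apply: uniq_leq_size; first by rewrite map_inj_uniq ?iota_uniq.
  by move=> x /mapP[n _ ->].
by rewrite size_map size_iota ltnn.
Qed.

End ChangeOfRings.

(** * Envelopes with the unique mapping property *)

Section UniqueMappingProperty.
Variables (R : comPzRingType) (C : lmodType R -> Prop).

(** Maps out of an envelope into the class are determined on the image of the
    module, even if that image is small. *)
Lemma unique_mapping_eq (A Q P : lmodType R) (f : {linear A -> Q})
    (g h : {linear Q -> P}) :
  unique_mapping_property C f -> C P -> g \o f =1 h \o f -> g =1 h.
Proof.
move=> ump CP gh; have [k [_ kU]] := ump P CP (g \o f).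
by move=> x; rewrite (kU g) // (kU h).
Qed.

(** The inclusion of ker p extends to i : Q -> P.  Since p i and 0 agree on
    ker p, they are equal, so i takes its values in ker p. *)
Lemma unique_mapping_kernel (P P' Q : lmodType R) (p : {linear P -> P'})
    (f : {linear kernel p -> Q}) :
  C P -> C P' -> unique_mapping_property C f ->
  exists r : {linear Q -> kernel p}, cancel f r.
Proof.
move=> CP CP' ump; have [i [iE _]] := ump P CP (kernel_incl p).
have pi0 x : p (i x) = 0.
  apply: (unique_mapping_eq (g := p \o i) (h := GRing.null_fun _) ump) => // y /=.
  by rewrite -[i (f y)](iE y); exact: submoduleP y.
pose r x : kernel p := in_submodule (is_submodule_ker p) (pi0 x).
have rL : linear r by move=> a x y; apply: val_inj; exact: linearP.
exists (linear_map_of rL) => x; apply: val_inj.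
by rewrite -[LHS]/(i (f x)) -[LHS](iE x).
Qed.

(** The coordinate projections extend to Q one by one, and the extensions
    together form a map to the power. *)
Lemma unique_mapping_power (X : Type) (P Q : lmodType R)
    (f : {linear (X -> P) -> Q}) :
  C P -> unique_mapping_property C f ->
  exists r : {linear Q -> (X -> P)}, cancel f r.
Proof.
move=> CP ump.
have [r rE] : exists r : X -> {linear Q -> P}, forall i x, x i = r i (f x).
  suff H i : exists r : {linear Q -> P}, forall x : X -> P, x i = r (f x).
    by exists (fun i => sval (cid (H i))) => i; exact: svalP (cid (H i)).
  have [r [rE _]] := ump P CP (eval_at P i).
  by exists r.
have rL : linear (fun q i => r i q).
  by move=> a x y; apply/funext => i; exact: linearP.
by exists (linear_map_of rL) => x; apply/funext => i; rewrite [RHS]rE.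
Qed.

End UniqueMappingProperty.

Lemma projective_regular_module (R : comPzRingType) : projective (R^o : lmodType R).
Proof.
move=> A B p f surjp; have [x px] := surjp (f 1).
have gL : linear (fun r : R^o => r *: x) by move=> a r s; rewrite scalerDl scalerA.
exists (linear_map_of gL) => r /=.
by rewrite linearZZ px -linearZZ; congr (f _); exact: esym (mulr1 r).
Qed.

(** [Ext1_eq0] quantifies over all resolutions, so a given one has to be treated.
    A section s of its augmentation makes x - s (aug x) a boundary d y for every
    x, and x |-> g y is a cochain that bounds g. *)
Lemma projective_Ext1_eq0 (R : comPzRingType) (M N : lmodType R) :
  projective M -> Ext1_eq0 M N.
Proof.
move=> projM P g gd.
have [s sE] := projM _ _ (res_aug P) idfun (@res_aug_surj _ _ P).
have lift x : exists y, res_diff P 0 y = x - s (res_aug P x).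
  by apply/res_exact0; rewrite linearB -[res_aug P (s _)]sE subrr.
pose h x := g (sval (cid (lift x))).
have hE x y : res_diff P 0 y = x - s (res_aug P x) -> h x = g y.
  move=> dy; rewrite /h; case: cid => z /= dz.
  have /res_exactS[w wE] : res_diff P 0 (z - y) = 0 by rewrite linearB dy dz subrr.
  by apply/eqP; rewrite -subr_eq0 -linearB -wE gd.
have hL : linear h.
  move=> a x y; have [[v vE] [w wE]] := (lift x, lift y).
  rewrite (hE _ _ vE) (hE _ _ wE) -linearP; apply: hE.
  by rewrite !linearP vE wE scalerBr addrACA -scalerN.
exists (linear_map_of hL) => y; apply/esym/hE.
have dy0 : res_aug P (res_diff P 0 y) = 0 by apply/res_exact0; exists y.
by rewrite dy0 linear0 subr0.
Qed.

Lemma almost_projective_regular_module (R : comPzRingType) :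
  almost_projective (R^o : lmodType R).
Proof. by move=> m N; exact/projective_Ext1_eq0/projective_regular_module. Qed.

(** * Modules over a von Neumann regular ring *)

Section VonNeumannRegular.
Variables (R : comPzRingType) (vnR : von_neumann_regular R) (m : maximal_ideal R).
Local Notation D := (localization_at m).
Local Notation tau := (to_localization_at m).
Local Notation restricted N := (restrict_scalars tau N).

(** From a = a x a, the element 1 - x a kills a, and it lies outside m as x a
    lies in m. *)
Lemma vnr_maximal_localizes_to_0 a : m a -> tau a = 0.
Proof.
have [[m0 mD mM] m1 _] := maxidealP m.
move=> ma; have [x ax] := vnR a; apply/localization_eq0; exists (1 - x * a).
  by move=> m1xa; apply: m1; rewrite -(subrK (x * a) 1); apply: mD => //; exact: mM.
by rewrite mulrBl mul1r mulrC mulrA -ax subrr.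
Qed.

Variables (N : lmodType D).

(** [W] is the graph of a partial map and n the value that it may be given at x.
    If s x lies in the domain for some s outside m, with value k, then n = k / s
    is forced, and it works.  Otherwise only multiples a x with a in m lie in
    the domain; from a = a y a the value at a x is a y times itself, hence zero
    as a acts as zero on N, and n = 0 works. *)
Lemma vnr_baer_criterion (A : lmodType R) (W : set (A * restricted N)%type) x :
    is_submodule W -> (forall n, W (0, n) -> n = 0) ->
  exists n : restricted N, forall a k, W (a *: x, k) -> k = a *: n.
Proof.
move=> subW W0; have [_ WD WZ] := subW.
case: (pselect (exists s k, ~ m s /\ W (s *: x, k))) => [[s [k [ms Wk]]]|noW].
  have [d ds1] := localization_inv ms.
  exists (d *: (k : N)) => a l Wl.
  have: W (s *: (a *: x, l) - a *: (s *: x, k)).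
    by apply: is_submoduleB => //; exact: WZ.
  rewrite (_ : _ - _ = (0, s *: l - a *: k)); last first.
    by congr pair; rewrite /= !scalerA mulrC subrr.
  move/W0/eqP; rewrite subr_eq0 => /eqP sl.
  rewrite -[l](scale1r (l : N)) -ds1 -scalerA -[tau s *: _]/(s *: l) sl.
  rewrite -[RHS]/(tau a *: (d *: (k : N))) -[a *: k]/(tau a *: (k : N)).
  by rewrite !scalerA mulrC.
exists 0 => a k Wk; rewrite scaler0.
have ma : m a by apply: contrapT => ma; apply: noW; exists a, k.
have [y ay] := vnR a.
have: W ((a *: x, k) - (a * y) *: (a *: x, k)).
  by apply: is_submoduleB => //; exact: WZ.
rewrite (_ : _ - _ = (0, k)) => [/W0 //|].
congr pair; rewrite /= ?scalerA -?ay ?subrr //.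
rewrite -[_ *: k]/(tau (a * y) *: (k : N)) rmorphM.
by rewrite vnr_maximal_localizes_to_0 // mul0r scale0r subr0.
Qed.

(** A 1-cocycle g is a map on the image of d, with graph [W0].  A maximal partial
    map that extends it is defined everywhere by [vnr_baer_criterion]. *)
Lemma vnr_Ext1_eq0 (M : lmodType R) : Ext1_eq0 M (restricted N).
Proof.
move=> P g gd; pose V : lmodType R := (P 0 * restricted N)%type.
pose W0 : set V := [set w | exists y, w = (res_diff P 0 y, g y)].
pose Bad : set V := [set w | w.1 = 0 /\ w.2 <> 0].
have subW0 : is_submodule W0.
  split=> [|_ _ [y ->] [z ->]|a _ [y ->]].
  - by exists 0; rewrite !linear0.
  - by exists (y + z); rewrite !linearD.
  - by exists (a *: y); rewrite !linearZZ.
have [_ [y ->] [/= /res_exactS[z <-]]|W [subW W0W badW maxW]] :=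
  maximal_submodule_avoiding (Bad := Bad) subW0.
  by rewrite gd.
have [W00 WD WZ] := subW.
have W_0 n : W (0, n) -> n = 0.
  by move=> Wn; apply: contrapT => n0; exact: (badW _ Wn).
have total x : exists n, W (x, n).
  have [n nP] := vnr_baer_criterion x subW W_0; exists n.
  (* The graph extended by the value n at x. *)
  pose W' : set V := [set w | exists a, W (w - a *: (x, n))].
  apply: (maxW W'); last by exists 1; rewrite scale1r subrr.
  - split=> [|v w [a Wa] [b Wb]|b v [a Wa]].
    + by exists 0; rewrite scale0r subr0.
    + by exists (a + b); rewrite scalerDl opprD addrACA; exact: WD.
    + by exists (b * a); rewrite -scalerA -scalerBr; exact: WZ.
  - by move=> w Ww; exists 0; rewrite scale0r subr0.
  move=> [w1 w2] [a Wa] [/= w10]; apply.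
  have := nP (- a) (w2 - a *: n); rewrite scaleNr => /(_ _)/eqP.
  move: Wa; rewrite w10 (_ : _ - _ = (- (a *: x), w2 - a *: n)); last first.
    by congr pair; rewrite /= sub0r.
  by move=> Wa /(_ Wa); rewrite scaleNr subr_eq addNr => /eqP.
pose h x := sval (cid (total x)).
have hP x : W (x, h x) by exact: svalP (cid (total x)).
have uniqW x n k : W (x, n) -> W (x, k) -> n = k.
  move=> Wn Wk; apply/eqP; rewrite -subr_eq0; apply/eqP/W_0.
  rewrite (_ : (0, _) = (x, n) - (x, k) :> V); first exact: is_submoduleB.
  by congr pair; rewrite /= subrr.
have hL : linear h.
  move=> a x y; apply: (uniqW (a *: x + y)) => //.
  exact: WD _ _ (WZ a _ (hP x)) (hP y).
exists (linear_map_of hL) => y; apply: (uniqW (res_diff P 0 y)); last exact: hP.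
by apply: W0W; exists y.
Qed.

End VonNeumannRegular.

(** * The equivalence *)

Lemma ideal_in_maximal (R : comPzRingType) (I : set R) :
  is_ideal I -> ~ I 1 -> exists m : maximal_ideal R, I `<=` m.
Proof.
move=> idI I1.
have [x Ix x1|m [idm Im m1 maxm]] :=
  @maximal_submodule_avoiding R R^o I [set 1] idI.
  by apply: I1; rewrite -[X in I X]x1.
have max : is_maximal_ideal (m : set R).
  split=> [//|m1'|J idJ mJ J1]; first exact: (m1 1).
  by apply: maxm => // x Jx x1; apply: J1; rewrite -[X in J X]x1.
by exists (MaximalIdeal max).
Qed.

Lemma von_neumann_regular_of_local_fields (R : comPzRingType) :
    (forall (m : maximal_ideal R) a, m a -> to_localization_at m a = 0) ->
  von_neumann_regular R.
Proof.
move=> fieldR a.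
(* I is the ideal of those r for which r a is a multiple of a^2.  If it is proper
   it lies in some m; then a is in m, since I contains a, and a vanishes in
   R_m, so it is killed by some u outside m.  But u belongs to I. *)
pose I : set R := [set r | exists x, r * a = a * x * a].
have idI : is_ideal I.
  split=> [|r s [x rx] [y sy]|b r [x rx]].
  - by exists 0; rewrite mulr0 !mul0r.
  - by exists (x + y); rewrite mulrDl rx sy; ring.
  - by exists (b * x); rewrite -mulrA rx; ring.
have [[x]|I1] := pselect (I 1); first by rewrite mul1r => ?; exists x.
have [m Im] := ideal_in_maximal idI I1; exfalso.
have ma : m a by apply: Im; exists 1; rewrite mulr1.
have [u mu ua0] := (localization_eq0 m a).1 (fieldR m a ma).
by apply: mu; apply: Im; exists 0; rewrite ua0 mulr0 mul0r.
Qed.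

Theorem theorem6 (R : comPzRingType) :
  von_neumann_regular R <->
  (forall M : lmodType R,
     exists (P : lmodType R) (f : {linear M -> P}),
       is_envelope (@almost_projective R) f /\
       unique_mapping_property (@almost_projective R) f).
Proof.
split=> [vnR M|env].
  exists M, idfun; split; last first.
    by move=> P _ f; exists f; split=> // g fg x; rewrite fg.
  split; last by move=> h hid; exists id => x; rewrite -[h x]hid.
  split=> [m N|P _ f]; first exact: vnr_Ext1_eq0.
  by exists f.
apply: von_neumann_regular_of_local_fields => m a ma.
have apR := @almost_projective_regular_module R.
have [Q [f [[[apQ _] _] ump]]] := env (kernel (scaling a)).
have [r fr] := unique_mapping_kernel apR apR ump.
have basisQ := almost_projective_dual_basis m apQ.
have [//|reg_a] := localization_annihilator (has_dual_basis_along_retract fr basisQ).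
have [Q' [f' [[[apQ' _] _] ump']]] := env (nat -> R^o).
have [r' fr'] := unique_mapping_power apR ump'.
have basisQ' := almost_projective_dual_basis m apQ'.
have := countable_power_no_dual_basis (nonunit_mod_maximal ma) reg_a.
by case; exact: has_dual_basis_along_retract fr' basisQ'.
Qed.
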